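(* Let $q\ge 2$ and $n\ge 1$ be integers, and let $S=(s_i)$ be an orientable sequence of order $n$ over $\mathbb{Z}_q$ with period $m$. Let $h$ be the additive order of $w_q(S)$ in $\mathbb{Z}_q$. Then there are $q/h$ sequences $T_1,\dots,T_{q/h}$, each a negative orientable sequence of order $n+1$ with period $hm$, which are translates of one another and pairwise no-disjoint, such that $D^{-1}(S)$ consists exactly of the $h$ shifts $(t_{i+km})_i$, $0\le k\le h-1$, of each $T_\ell=(t_i)$.
   Context: Sequences are periodic with entries in $\mathbb{Z}_q$; the period means the least period. For $S=(s_i)$ of period $m$, $\mathbf{s}_n(i)=(s_i,\dots,s_{i+n-1})$; the ring sequence is $[s_0,\dots,s_{m-1}]$ and $w_q(S)=\sum_{i=0}^{m-1}s_i \bmod q$. For a tuple $\mathbf{u}=(u_0,\dots,u_{n-1})$, $\mathbf{u}^R=(u_{n-1},\dots,u_0)$ and $-\mathbf{u}=(-u_0,\dots,-u_{n-1})$. $S$ is an $n$-window sequence if $\mathbf{s}_n(i)=\mathbf{s}_n(j)$ implies $i\equiv j\pmod m$. An orientable sequence of order $n$ is an $n$-window sequence with $\mathbf{s}_n(i)\neq\mathbf{s}_n(j)^R$ for all $i,j$; a negative orientable sequence of order $n$ is an $n$-window sequence with $\mathbf{s}_n(i)\neq-\mathbf{s}_n(j)^R$ for all $i,j$. Two $n$-window sequences $S,S'$ are disjoint if $\mathbf{s}_n(i)\neq\mathbf{s}'_n(j)$ for all $i,j$, and no-disjoint if they are disjoint and $\mathbf{s}_n(i)\neq-\mathbf{s}'_n(j)^R$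 for all $i,j$. A translate of $(t_i)$ is $(t_i+\lambda)$ for some nonzero $\lambda\in\mathbb{Z}_q$; a shift is $(t_{i+k})$. $D$ maps a periodic sequence $(t_i)$ to $(t_{i+1}-t_i)$, and $D^{-1}(S)$ is the set of all periodic sequences $T$ with $D(T)=S$. *)

(* Defs.v *)
From mathcomp Require Import all_boot all_order all_algebra all_fingroup.

Set Implicit Arguments.
Unset Strict Implicit.
Unset Printing Implicit Defensive.

Import GRing.Theory.
Local Open Scope ring_scope.

(* A sequence (s_i) over Z_q is a function s : nat -> 'Z_q. This agrees with *)
(* Z_q only for q > 1, since 'Z_0 and 'Z_1 both denote the integers mod 2.   *)

Definition has_period (q m : nat) (s : nat -> 'Z_q) : Prop :=
  (0 < m)%N /\ forall i : nat, s (i + m)%N = s i.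

Definition periodic (q : nat) (s : nat -> 'Z_q) : Prop :=
  exists m : nat, has_period m s.

Definition least_period (q m : nat) (s : nat -> 'Z_q) : Prop :=
  has_period m s /\ forall p : nat, has_period p s -> (m <= p)%N.

Definition window (q n : nat) (s : nat -> 'Z_q) (i : nat) : n.-tuple 'Z_q :=
  [tuple s (i + k)%N | k < n].

Definition opp_tuple (q n : nat) (u : n.-tuple 'Z_q) : n.-tuple 'Z_q :=
  [tuple of [seq - x | x <- u]].

Definition rev_window (q n : nat) (s : nat -> 'Z_q) (i : nat) :
  n.-tuple 'Z_q := [tuple of rev (window n s i)].

Definition weight (q m : nat) (s : nat -> 'Z_q) : 'Z_q := \sum_(i < m) s i.

(* In the next three definitions, m is the (least) period of s. *)

Definition window_sequence (q n m : nat) (s : nat -> 'Z_q) : Prop :=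
  least_period m s /\
  forall i j : nat, window n s i = window n s j -> i = j %[mod m].

Definition orientable (q n m : nat) (s : nat -> 'Z_q) : Prop :=
  window_sequence n m s /\
  forall i j : nat, window n s i <> rev_window n s j.

Definition negative_orientable (q n m : nat) (s : nat -> 'Z_q) : Prop :=
  window_sequence n m s /\
  forall i j : nat, window n s i <> opp_tuple (rev_window n s j).

Definition disjoint_seq (q n : nat) (s s' : nat -> 'Z_q) : Prop :=
  forall i j : nat, window n s i <> window n s' j.

Definition no_disjoint (q n : nat) (s s' : nat -> 'Z_q) : Prop :=
  disjoint_seq n s s' /\
  forall i j : nat, window n s i <> opp_tuple (rev_window n s' j).

Definition translate_of (q : nat) (t t' : nat -> 'Z_q) : Prop :=
  exists2 lambda : 'Z_q, lambda != 0 & forall i : nat, t' i = t i + lambda.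

Definition shift_seq (q k : nat) (t : nat -> 'Z_q) : nat -> 'Z_q :=
  fun i => t (i + k)%N.

Definition D (q : nat) (t : nat -> 'Z_q) : nat -> 'Z_q :=
  fun i => t i.+1 - t i.

Definition D_preimage (q : nat) (s t : nat -> 'Z_q) : Prop :=
  periodic t /\ D t =1 s.

(* The finGroupType structure of 'Z_q is its additive group, so #[a] is the  *)
(* additive order of a.                                                      *)
Definition additive_order (q : nat) (a : 'Z_q) : nat := #[a]%g.

(* Main.v *)
Require Import Defs.
From mathcomp Require Import all_boot all_order all_algebra all_fingroup.
From mathcomp Require Import cyclic.

(** The sequences T with D T = S are the T_c with T_c(0) = c, for c in Z_q, and
    T_c(i + m) = T_c(i) + w where w = w_q(S). Hence T_c has period h m, its
    shifts by multiples of m are the T_c' with c' in the coset c + <w>, and the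
    T_l are obtained by taking one c in each coset, namely c = 0, ..., q/h - 1.
    Under D, an equality of (n+1)-windows of two such sequences becomes an
    equality of n-windows of S, which fixes the position modulo m, and an
    equality up to reversal and negation becomes an equality up to reversal,
    which is impossible. *)

Set Implicit Arguments.
Unset Strict Implicit.
Unset Printing Implicit Defensive.

Import GRing.Theory.
Local Open Scope ring_scope.

Lemma eq_window q n (s t : nat -> 'Z_q) i j :
  window n s i = window n t j <->
  forall k, (k < n)%N -> s (i + k)%N = t (j + k)%N.
Proof.
split=> [e k lt_kn | e]; last first.
  by apply: eq_from_tnth => k; rewrite !tnth_mktuple e.
by have := congr1 (fun u => tnth u (Ordinal lt_kn)) e; rewrite !tnth_mktuple.
Qed.

Lemma nth_window q n (s : nat -> 'Z_q) i k :
  (k < n)%N -> nth 0 (window n s i) k = s (i + k)%N.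
Proof.
by move=> lt_kn; rewrite (_ : k = Ordinal lt_kn) // -tnth_nth tnth_mktuple.
Qed.

Lemma nth_rev_window q n (s : nat -> 'Z_q) i k :
  (k < n)%N -> nth 0 (rev_window n s i) k = s (i + (n - k.+1))%N.
Proof.
move=> lt_kn; rewrite nth_rev ?size_tuple // nth_window //.
by rewrite ltn_subrL (leq_ltn_trans _ lt_kn).
Qed.

Lemma eq_rev_window q n (s t : nat -> 'Z_q) i j :
  (forall k, (k < n)%N -> s (i + k)%N = t (j + (n - k.+1))%N) ->
  window n s i = rev_window n t j.
Proof.
move=> e; apply: eq_from_tnth => k; rewrite !(tnth_nth 0).
by rewrite nth_window // nth_rev_window // e.
Qed.

Lemma opp_rev_windowE q n (s t : nat -> 'Z_q) i j k :
  window n s i = opp_tuple (rev_window n t j) -> (k < n)%N ->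
  s (i + k)%N = - t (j + (n - k.+1))%N.
Proof.
move=> e lt_kn; rewrite -(nth_window _ _ lt_kn) e (nth_map 0) ?size_tuple //.
by rewrite nth_rev_window.
Qed.

Lemma mulrn_additive_order q (a : 'Z_q) k :
  (a *+ k == 0) = (additive_order a %| k)%N.
Proof. by rewrite /additive_order order_dvdn FinRing.zmodXgE. Qed.

Lemma mulrn_additive_order0 q (a : 'Z_q) : a *+ additive_order a = 0.
Proof. by apply/eqP; rewrite mulrn_additive_order. Qed.

Lemma additive_order_dvd q (a : 'Z_q) : (1 < q)%N -> (additive_order a %| q)%N.
Proof. by move=> q_gt1; rewrite -mulrn_additive_order -mulr_natr pchar_Zp ?mulr0. Qed.

Lemma has_period_mul q m (s : nat -> 'Z_q) :
  has_period m s -> forall k i, s (i + k * m)%N = s i.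
Proof.
case=> _ sP; elim=> [|k IHk] i; first by rewrite addn0.
by rewrite mulSnr addnA sP.
Qed.

Lemma Dsucc q (s t : nat -> 'Z_q) i : D t =1 s -> t i.+1 = t i + s i.
Proof. by move=> /(_ i) <-; rewrite addrC subrK. Qed.

Lemma D_eq_translate q (t u : nat -> 'Z_q) :
  D t =1 D u -> forall i, t i = u i + (t 0%N - u 0%N).
Proof.
move=> e; elim=> [|i IHi]; first by rewrite addrC subrK.
by rewrite (Dsucc _ e) IHi addrAC (@Dsucc _ _ u i (frefl _)).
Qed.

(** Each [t i] is [t 0] plus a partial sum of [s], so crossing one period of [s] adds the weight. *)
Lemma D_shift_period q m (s t : nat -> 'Z_q) :
  has_period m s -> D t =1 s ->
  forall k i, t (i + k * m)%N = t i + weight m s *+ k.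
Proof.
move=> [_ sP] Dt.
have t_sum i : t i = t 0%N + \sum_(j < i) s j.
  elim: i => [|i IHi]; first by rewrite big_ord0 addr0.
  by rewrite big_ord_recr /= addrA -IHi (Dsucc _ Dt).
have step i : t (i + m)%N = t i + weight m s.
  (* At [0] this is [t_sum m], by definition of [weight]; periodicity of [s] carries it along. *)
  elim: i => [|i IHi]; first exact: t_sum.
  by rewrite addSn !(Dsucc _ Dt) IHi sP addrAC.
elim=> [|k IHk] i; first by rewrite addn0 addr0.
by rewrite mulSnr addnA step IHk mulrSr addrA.
Qed.

Lemma D_window q n (s t u : nat -> 'Z_q) i j :
  D t =1 s -> D u =1 s -> window n.+1 t i = window n.+1 u j ->
  window n s i = window n s j.
Proof.
move=> Dt Du /eq_window e; apply/eq_window => k lt_kn.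
by rewrite -Dt -Du /D -!addnS !e // ltnW.
Qed.

(** Reversing a tuple reverses its differences and flips their signs; negation flips the signs
    back. *)
Lemma D_opp_rev_window q n (s t u : nat -> 'Z_q) i j :
  D t =1 s -> D u =1 s ->
  window n.+1 t i = opp_tuple (rev_window n.+1 u j) ->
  window n s i = rev_window n s j.
Proof.
move=> Dt Du e; apply: eq_rev_window => k lt_kn.
rewrite -Dt -Du /D -!addnS !(opp_rev_windowE e) //; last exact: ltnW.
by rewrite opprK addrC !subSS -subSn.
Qed.

(* Equal (n+1)-windows force the two initial terms into the same coset. *)
Lemma D_window_coset q n m (s t u : nat -> 'Z_q) i j :
  window_sequence n m s -> D t =1 s -> D u =1 s ->
  window n.+1 t i = window n.+1 u j ->
  (t 0%N - u 0%N) *+ additive_order (weight m s) = 0.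
Proof.
move=> [[sP _] sW] Dt Du e; have ij := sW _ _ (D_window Dt Du e).
(* In a cyclic group the multiples of [w] are exactly the elements killed by its order, so this
   multiplication tests for equal cosets. *)
have w0 k : weight m s *+ k *+ additive_order (weight m s) = 0.
  by apply/eqP; rewrite -mulrnA mulrn_additive_order dvdn_mull.
(* The first entries suffice: [i] and [j] have the same remainder modulo [m], and the quotients
   contribute multiples of [w]. *)
have /eq_window/(_ 0%N isT) := e; rewrite !addn0.
rewrite (divn_eq i m) (divn_eq j m) ij ![(_ * m + _)%N]addnC.
rewrite !(D_shift_period sP) // (@D_eq_translate _ t u); last first.
  by move=> k; rewrite Dt Du.
rewrite -addrA => /addrI e0.
have -> : t 0%N - u 0%N = weight m s *+ (j %/ m) - weight m s *+ (i %/ m).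
  by rewrite -e0 addrK.
by rewrite mulrnBl !w0 subrr.
Qed.

(** The window property of [s] gives [j = i + k * m]; comparing first entries then gives
    [w *+ k = 0], so the order of [w] divides [k]. *)
Lemma D_window_mod q n m (s t : nat -> 'Z_q) i j :
  window_sequence n m s -> D t =1 s ->
  window n.+1 t i = window n.+1 t j ->
  i = j %[mod additive_order (weight m s) * m].
Proof.
move=> [[sP _] sW] Dt; wlog le_ij : i j / (i <= j)%N => [hw e|].
  by case/orP: (leq_total i j) => le; [|symmetry]; apply: hw.
move=> e; have /esym/eqP := sW _ _ (D_window Dt Dt e).
rewrite eqn_mod_dvd // => /dvdnP[k jk].
have ej : j = (i + k * m)%N by rewrite -jk subnKC.
apply/esym/eqP; rewrite eqn_mod_dvd // jk dvdn_mul // -mulrn_additive_order.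
have /eq_window/(_ 0%N isT) := e; rewrite !addn0 ej (D_shift_period sP Dt).
by move/eqP; rewrite -subr_eq0 opprD addrA subrr add0r oppr_eq0.
Qed.

Lemma D_has_period q m (s t : nat -> 'Z_q) :
  has_period m s -> D t =1 s -> has_period (additive_order (weight m s) * m) t.
Proof.
move=> sP Dt; split=> [|i]; first by rewrite muln_gt0 order_gt0 sP.1.
by rewrite (D_shift_period sP Dt) mulrn_additive_order0 addr0.
Qed.

Lemma D_window_sequence q n m (s t : nat -> 'Z_q) :
  window_sequence n m s -> D t =1 s ->
  window_sequence n.+1 (additive_order (weight m s) * m) t.
Proof.
move=> sW Dt; split; last by move=> i j; apply: D_window_mod.
split=> [|p [p_gt0 tp]]; first exact: D_has_period sW.1.1 Dt.
(* Any period [p] repeats the window at [0], hence is a multiple of the claimed least period. *)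
have /(D_window_mod sW Dt)/eqP : window n.+1 t p = window n.+1 t 0.
  by apply/eq_window => k _; rewrite addnC tp.
by rewrite eqn_mod_dvd // subn0 => /dvdn_leq; apply.
Qed.

Lemma D_negative_orientable q n m (s t : nat -> 'Z_q) :
  orientable n m s -> D t =1 s ->
  negative_orientable n.+1 (additive_order (weight m s) * m) t.
Proof.
move=> [sW sO] Dt; split; first exact: D_window_sequence.
by move=> i j /(D_opp_rev_window Dt Dt) /sO.
Qed.

Lemma D_no_disjoint q n m (s t u : nat -> 'Z_q) :
  orientable n m s -> D t =1 s -> D u =1 s ->
  (t 0%N - u 0%N) *+ additive_order (weight m s) != 0 ->
  no_disjoint n.+1 t u.
Proof.
move=> [sW sO] Dt Du neq; split=> i j.
  by move=> /(D_window_coset sW Dt Du) e; rewrite e eqxx in neq.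
by move/(D_opp_rev_window Dt Du)/sO.
Qed.

(** Multiplied by the order of [a], both representatives stay below [q], so congruence modulo [q] is
    equality of integers. *)
Lemma Zq_sub_mulrn_eq0 q (a : 'Z_q) (l l' : 'I_(q %/ additive_order a)) :
  (1 < q)%N -> (l%:R - l'%:R : 'Z_q) *+ additive_order a = 0 -> l = l'.
Proof.
move=> q_gt1; have dvd_q := additive_order_dvd a q_gt1.
have h_gt0 : (0 < additive_order a)%N by apply: order_gt0.
have lt_q (x : 'I_(q %/ additive_order a)) : (x * additive_order a < q)%N.
  by rewrite -ltn_divRL.
move/eqP; rewrite mulrnBl -!mulrnA subr_eq0 => /eqP/(congr1 val).
rewrite /= !val_Zp_nat // !modn_small // => /eqP.
by rewrite eqn_pmul2r // => /eqP/val_inj.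
Qed.

(** By counting: the map from pairs [(l, k)] is injective between sets of [q] elements, hence
    onto. *)
Lemma Zq_coset_decomposition q (a : 'Z_q) : (1 < q)%N -> forall c : 'Z_q,
  exists (l : 'I_(q %/ additive_order a)) (k : 'I_(additive_order a)),
    c = l%:R + a *+ k.
Proof.
move=> q_gt1 c; set h := additive_order a.
pose f (x : 'I_(q %/ h) * 'I_h) : 'Z_q := x.1%:R + a *+ x.2.
have f_inj : injective f.
  move=> [l k] [l' k']; rewrite /f /= => e.
  have el : l = l'.
    apply: Zq_sub_mulrn_eq0 => //.
    have -> : (l%:R - l'%:R : 'Z_q) = a *+ k' - a *+ k.
      by apply/eqP; rewrite subr_eq addrAC eq_sym subr_eq e addrC.
    apply/eqP; rewrite mulrnBl -!mulrnA ![(_ * h)%N]mulnC !mulrnA.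
    by rewrite mulrn_additive_order0 !mul0rn subrr.
  rewrite -el in e *; congr pair; apply/val_inj/eqP.
  have /eqP := addrI _ e; rewrite -!FinRing.zmodXgE eq_expg_mod_order.
  by rewrite !modn_small.
have card_f : (#|'Z_q| <= #|{: 'I_(q %/ h) * 'I_h}|)%N.
  by rewrite card_prod !card_ord Zp_cast // divnK // additive_order_dvd.
have /codomP[[l k] ->] := inj_card_onto f_inj card_f c.
by exists l, k.
Qed.

Theorem theorem5 (q n m h : nat) (S : nat -> 'Z_q)
    (hq : (2 <= q)%N) (hn : (1 <= n)%N)
    (hS : orientable n m S) (hh : h = additive_order (weight m S)) :
  exists T : 'I_(q %/ h) -> nat -> 'Z_q,
    [/\ forall l : 'I_(q %/ h), negative_orientable n.+1 (h * m) (T l),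
        forall l l' : 'I_(q %/ h), l != l' -> translate_of (T l) (T l'),
        forall l l' : 'I_(q %/ h), l != l' -> no_disjoint n.+1 (T l) (T l')
      & forall U : nat -> 'Z_q,
          D_preimage S U <->
          exists (l : 'I_(q %/ h)) (k : 'I_h), U =1 shift_seq (k * m) (T l)].
Proof.
subst h; set h := additive_order _.
have sP : has_period m S by case: hS => [[[]]].
pose T (l : 'I_(q %/ h)) i : 'Z_q := l%:R + \sum_(j < i) S j.
have T0 l : T l 0%N = l%:R by rewrite /T big_ord0 addr0.
have DT l : D (T l) =1 S.
  by move=> i; rewrite /D /T big_ord_recr /= opprD addrACA subrr add0r addrAC subrr add0r.
have T_neq l l' : l != l' -> (T l 0%N - T l' 0%N) *+ h != 0.
  apply: contra_neq; rewrite !T0; exact: Zq_sub_mulrn_eq0.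
exists T; split=> [l|l l' neq|l l' neq|U].
- exact: D_negative_orientable.
- exists (T l' 0%N - T l 0%N); last first.
    by apply: D_eq_translate => i; rewrite !DT.
  (* The translation constant is nonzero because even its multiple by [h] is. *)
  rewrite eq_sym in neq; apply: contraNneq (T_neq _ _ neq) => ->.
  by rewrite mul0rn.
- exact: D_no_disjoint (T_neq _ _ neq).
split=> [[_ DU]|[l [k eU]]].
  (* The coset of [U 0] selects [l], and the position inside it selects [k], since shifting by
     [k * m] adds [w *+ k]. *)
  have [l [k eU]] := @Zq_coset_decomposition q (weight m S) hq (U 0%N).
  exists l, k => i; rewrite /shift_seq (D_shift_period sP) //.
  rewrite (@D_eq_translate _ U (T l)); last by move=> j; rewrite DU DT.
  by rewrite T0 eU [l%:R + _]addrC addrK.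
split=> [|i].
  exists (h * m)%N; have [hm_gt0 Tp] := D_has_period sP (DT l).
  by split=> // i; rewrite !eU /shift_seq addnAC Tp.
by rewrite /D !eU /shift_seq addSn -(has_period_mul sP k i); apply: DT.
Qed.
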